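(* For any $s=1,\dots,ak$, the arithmetic solution $P^{sp-1}(z)=(P^{sp-1}_1(z),\dots,P^{sp-1}_n(z))$ satisfies the relation $$P^{sp-1}_1(z)+\dots+P^{sp-1}_n(z)=0,$$ and, for any $i=1,\dots,n$, the relation $$\sum_{m\ge0}\ \sum_{\substack{l_0+\dots+l_m=M\\ l_0,\dots,l_m>0}}\Big(\sum_{\substack{1\le j\le n\\ j\ne i}}\frac{M}{(z_j-z_i)^{l_0}}P^{sp-1}_j(z)-C_{i,l_0}(z)P^{sp-1}_i(z)\Big)\prod_{r=1}^m\frac{C_{i,l_r}(z)}{l_1+\dots+l_r}=0 .$$ Moreover, these relations generate the space $\operatorname{Ann}(\mathcal{M}_{\mathbb{F}_p(z)})$. That is, the following $n+1$ vectors in $\mathbb{F}_p(z)^n$ span $\operatorname{Ann}(\mathcal{M}_{\mathbb{F}_p(z)})$ over $\mathbb{F}_p(z)$: the vector $(1,\dots,1)$, and, for each $i=1,\dots,n$, the vector of coefficients of $P^{sp-1}_1,\dots,P^{sp-1}_n$ in the second relation (these coefficients do not depend on $s$).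
   Context: Let $p,q$ be prime numbers, $k$ a positive integer, $n=kq+1$, and $p>n$. Let $z=(z_1,\dots,z_n)$, and let $\mathbb{F}_p(z)=\mathbb{F}_p(z_1,\dots,z_n)$ be the field of rational functions. Let $a$ be the unique integer with $1\le a<q$ and $q\mid(ap-1)$; put $M=(ap-1)/q\in\mathbb{Z}_{>0}$. Let $\Phi(x,z)=\prod_{i=1}^n(x-z_i)^M$ over $\mathbb{F}_p$, and define vectors $P^i(z)=(P^i_1(z),\dots,P^i_n(z))\in\mathbb{F}_p[z_1,\dots,z_n]^n$ by the expansion $$\Big(\frac{\Phi(x,z)}{x-z_1},\dots,\frac{\Phi(x,z)}{x-z_n}\Big)=\sum_i P^i(z)\,x^i .$$ The vectors $P^{lp-1}(z)$, $l=1,\dots,ak$, are called arithmetic solutions, and $\mathcal{M}_{\mathbb{F}_p(z)}$ is the $\mathbb{F}_p(z)$-subspace of $\mathbb{F}_p(z)^n$ spanned by them. Its annihilator is $$\operatorname{Ann}(\mathcal{M}_{\mathbb{F}_p(z)})=\Big\{(c_1,\dots,c_n)\in\mathbb{F}_p(z)^n\ \Big|\ \sum_{j=1}^nc_j(z)P^{lp-1}_j(z)=0,\ l=1,\dots,ak\Big\}.$$ For $m\ge1$ and $i=1,\dots,n$, $$C_{i,m}(z)=\sum_{\substack{1\le j\le n\\ j\ne i}}\frac{M}{(z_j-z_i)^m}.$$ The double sum in the claim ranges over all integers $m\ge0$ and all $(m+1)$-tuples of positive integers $(l_0,\dots,l_m)$ with sum $M$. For $m=0$ the empty product equals $1$.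 The integers $l_1+\dots+l_r$ in the denominators are regarded as elements of $\mathbb{F}_p$. *)

(* Defs.v *)
From mathcomp Require Export all_boot all_order all_algebra.
From mathcomp Require Export mpoly.

Set Implicit Arguments.
Unset Strict Implicit.
Unset Printing Implicit Defensive.

Import GRing.Theory.
Local Open Scope ring_scope.

(* F_p(z_1, ..., z_n); the indices 1..n of the mathematics are the elements of
   'I_n, i.e. they are shifted by one. *)
Notation ratfun p n := {fraction {mpoly 'F_p[n]}}.

Section Definitions.

Variables (p n M : nat).

Local Notation A := {mpoly 'F_p[n]}.
Local Notation K := (ratfun p n).

Definition master : {poly A} := \prod_(i < n) ('X - ('X_i : A)%:P) ^+ M.

(* The divisor is monic and, for M > 0, divides [master], so the pseudo-division
   %/ of polynomials over the integral domain A is here the exact quotient. *)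
Definition Pcoef (i : nat) : 'rV[A]_n :=
  \row_j (master %/ ('X - ('X_j : A)%:P))`_i.

Definition Psol (i : nat) : 'rV[K]_n := map_mx (@tofrac A) (Pcoef i).

Definition inAnn (a k : nat) (c : 'rV[K]_n) : Prop :=
  forall l : nat, (1 <= l <= a * k)%N ->
    \sum_(j < n) c 0 j * Psol (l * p - 1) 0 j = 0.

Definition zvar (i : 'I_n) : K := tofrac ('X_i : A).

Definition Csum (i : 'I_n) (m : nat) : K :=
  \sum_(j < n | j != i) M%:R / (zvar j - zvar i) ^+ m.

(* (m+1)-tuples (l_0, ..., l_m) of positive integers with sum M; the parts are
   at most M, whence the codomain 'I_M.+1. *)
Definition composition (m : nat) (l : {ffun 'I_m.+1 -> 'I_M.+1}) : bool :=
  [forall r, (0 < l r)%N] && (\sum_r l r == M)%N.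

(* prod_(r = 1..m) C_(i, l_r) / (l_1 + ... + l_r) *)
Definition weight (i : 'I_n) (m : nat) (l : {ffun 'I_m.+1 -> 'I_M.+1}) : K :=
  \prod_(r < m.+1 | (1 <= r)%N)
     (Csum i (l r) / (\sum_(t < m.+1 | (1 <= t <= r)%N) l t)%N%:R).

(* A sum over all m >= 0 and all compositions of M into m+1 parts: there are
   none for m >= M, so the range m < M loses nothing. *)
Definition relation (i : 'I_n) (v : 'rV[K]_n) : K :=
  \sum_(m < M) \sum_(l : {ffun 'I_m.+1 -> 'I_M.+1} | composition l)
    (\sum_(j < n | j != i) M%:R / (zvar j - zvar i) ^+ l ord0 * v 0 j
       - Csum i (l ord0) * v 0 i) * weight i l.

(* The coefficients of v_1, ..., v_n in [relation i v]. *)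
Definition relation_vec (i : 'I_n) : 'rV[K]_n :=
  \row_j \sum_(m < M) \sum_(l : {ffun 'I_m.+1 -> 'I_M.+1} | composition l)
    (if j == i then - Csum i (l ord0)
     else M%:R / (zvar j - zvar i) ^+ l ord0) * weight i l.

End Definitions.

(* Main.v *)
Require Import Defs.
From mathcomp Require Import all_boot all_order all_algebra.
From mathcomp Require Import mpoly.
From mathcomp Require Import ring zify.

(* With Phi_j = Phi / (x - z_j), every P^(lp-1) is a row of coefficients of the
   Phi_j at x^(lp-1), so c is in the annihilator iff all coefficients at x^(lp-1)
   of sum_j c_j Phi_j vanish, i.e. iff sum_j c_j Phi_j has an antiderivative h
   over F_p(z), of degree at most nM = deg Phi.  The antiderivative Phi / M gives
   (1, ..., 1).  The i-th relation comes from h_i = Phi * r_i, where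
   r_i = sum_(w = 1..M) b_w (x - z_i)^(-w) is the polar part with b_M = 1 for which
   h_i' / Phi has only simple poles; solving for the b_w recursively yields the
   sum over compositions.
   Conversely h' is divisible by (x - z_i)^(M-1), so h - h(z_i) is divisible by
   (x - z_i)^M because M < p.  As h_i vanishes at z_j for j != i but not at z_i, a
   combination of the h_i has the same values as h at all z_i; the difference is
   divisible by Phi, hence a scalar multiple of Phi for degree reasons. *)

Import GRing.Theory.

Local Open Scope ring_scope.

(** * Sums over compositions *)

Section Compositions.

Variables (F : fieldType) (M : nat) (C : nat -> F).

(** Convertible to [weight] when [C] is [Csum p M i]; an abstract sequence [C] keeps the
    combinatorics free of z. *)
Definition partial_sums_weight (m : nat) (l : {ffun 'I_m.+1 -> 'I_M.+1}) : F :=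
  \prod_(r < m.+1 | (1 <= r)%N)
     (C (l r) / (\sum_(t < m.+1 | (1 <= t <= r)%N) l t)%N%:R).

(* [comp_sum m t] is the sum of prod_r C_(l_r) / (l_1 + ... + l_r) over the
   compositions (l_1, ..., l_m) of t, obtained by peeling off l_m; the bound M.+1
   only serves to keep the range of u independent of t <= M. *)
Fixpoint comp_sum (m t : nat) : F :=
  if m is m'.+1 then
    t%:R^-1 * \sum_(u < M.+1 | (0 < u <= t)%N) C u * comp_sum m' (t - u)
  else (t == 0)%:R.

Definition comp_total (t : nat) : F := \sum_(m < M) comp_sum m t.

Lemma comp_sum_small (m t : nat) : (t < m)%N -> comp_sum m t = 0.
Proof.
elim: m t => // m IH t tm /=; rewrite big1 ?mulr0 // => u /andP[u0 ut].
by rewrite IH ?mulr0 //; lia.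
Qed.

Lemma comp_total0 : (0 < M)%N -> comp_total 0 = 1.
Proof.
rewrite /comp_total; case: M => // N _; rewrite big_ord_recl big1 ?addr0 //.
by move=> i _; apply: comp_sum_small.
Qed.

(** The partial sum at the last part u of a composition of t is t itself, so multiplication by t
    cancels the outermost denominator. *)
Lemma comp_total_rec (t : nat) :
  (forall m, (0 < m < M)%N -> m%:R != 0 :> F) -> (t < M)%N ->
  t%:R * comp_total t =
  \sum_(u < M.+1 | (0 < u <= t)%N) C u * comp_total (t - u).
Proof.
move=> nz tM; have [->|t0] := posnP t.
  by rewrite mul0r big1 // => u; lia.
have sum_recr (f : nat -> F) N :
    (0 < N)%N -> \sum_(m < N) f m = \sum_(m < N.-1) f m + f N.-1.
  by case: N => // N _; rewrite big_ord_recr.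
have sum_recl (f : nat -> F) N :
    (0 < N)%N -> \sum_(m < N) f m = f 0%N + \sum_(m < N.-1) f m.+1.
  by case: N => // N _; rewrite big_ord_recl.
have M0 : (0 < M)%N by lia.
(* Both sides shrink to M - 1 terms: on the right the top term vanishes since t - u < M - 1, on the
   left the term m = 0 vanishes since t > 0. *)
rewrite /comp_total; under [RHS]eq_bigr => u ut.
  rewrite (sum_recr (comp_sum ^~ _)) //= (comp_sum_small M.-1); last by lia.
  rewrite addr0 mulr_sumr; over.
rewrite (sum_recl (comp_sum ^~ t)) //= (_ : t == 0 = false) ?add0r; last by lia.
rewrite exchange_big mulr_sumr; apply: eq_bigr => m _ /=.
by rewrite mulrA divff ?mul1r // nz // t0.
Qed.

Definition ffun_rcons (m : nat) (x : 'I_M.+1 * {ffun 'I_m -> 'I_M.+1}) :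
    {ffun 'I_m.+1 -> 'I_M.+1} :=
  [ffun r => if unlift ord_max r is Some r' then x.2 r' else x.1].

Lemma ffun_rcons_max m x : @ffun_rcons m x ord_max = x.1.
Proof. by rewrite ffunE unlift_none. Qed.

Lemma ffun_rcons_widen m x r :
  @ffun_rcons m x (widen_ord (leqnSn m) r) = x.2 r.
Proof.
rewrite ffunE; have -> : widen_ord (leqnSn m) r = lift ord_max r.
  by apply: val_inj; rewrite [RHS]lift_max.
by rewrite liftK.
Qed.

Lemma ffun_rcons_first m x : ffun_rcons m.+1 x ord0 = x.2 ord0.
Proof.
rewrite -(ffun_rcons_widen _ x ord0); congr (ffun_rcons _ x _).
exact: val_inj.
Qed.

Lemma ffun_rcons_bij m : bijective (@ffun_rcons m).
Proof.
exists (fun l : {ffun 'I_m.+1 -> 'I_M.+1} =>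
  (l ord_max, [ffun r => l (lift ord_max r)])).
  move=> [u l]; congr (_, _); first by rewrite ffunE unlift_none.
  by apply/ffunP => r; rewrite !ffunE liftK.
move=> l; apply/ffunP => r; rewrite !ffunE.
by case: unliftP => [r'|] ->; rewrite ?ffunE.
Qed.

(** The last denominator is written as the total minus l_0: for a fixed total it depends on the
    first part only. *)
Lemma partial_sums_weight_rcons m (x : 'I_M.+1 * {ffun 'I_m.+1 -> 'I_M.+1}) :
  partial_sums_weight m.+1 (ffun_rcons m.+1 x) =
  partial_sums_weight m x.2 *
  (C x.1 / (\sum_(r < m.+2) ffun_rcons m.+1 x r - x.2 ord0)%N%:R).
Proof.
rewrite /partial_sums_weight big_mkcond big_ord_recr -big_mkcond /=.
rewrite ffun_rcons_max; congr (_ * (_ / _%:R)).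
  apply: eq_bigr => r _; rewrite ffun_rcons_widen; congr (_ / _%:R).
  rewrite big_mkcond big_ord_recr -big_mkcond /=.
  rewrite ifF ?addn0; last by apply/negbTE; have := ltn_ord r; lia.
  by apply: eq_bigr => t _; rewrite ffun_rcons_widen.
rewrite [in RHS]big_ord_recl.
rewrite ffun_rcons_first addKn big_mkcond [LHS]big_ord_recl /= add0n.
apply: eq_bigr => t _.
by rewrite ifT //= /bump; have := ltn_ord t; lia.
Qed.

(** Induction on m, removing the last part. [T] is general because the removal lowers it, and [G]
    because it absorbs the denominator T - l_0 that the removed part leaves behind. *)
Lemma sum_compositions (m T : nat) (G : nat -> F) : (T <= M)%N ->
  \sum_(l : {ffun 'I_m.+1 -> 'I_M.+1}
           | [forall r, (0 < l r)%N] && (\sum_r l r == T)%N)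
     G (l ord0) * partial_sums_weight m l =
  \sum_(v < M.+1 | (0 < v <= T)%N) G v * comp_sum m (T - v).
Proof.
elim: m T G => [|m IH] T G TM.
  pose cst (v : 'I_M.+1) : {ffun 'I_1 -> 'I_M.+1} := [ffun => v].
  rewrite (reindex cst); last first.
    apply: onW_bij; exists (fun l : {ffun 'I_1 -> 'I_M.+1} => l ord0).
      by move=> v; rewrite ffunE.
    by move=> l; apply/ffunP => r; rewrite ffunE (ord1 r).
  have posE v : [forall r, (0 < cst v r)%N] = (0 < v)%N.
    by apply/forallP/idP => [/(_ ord0)|v0 r]; rewrite ffunE.
  rewrite [RHS]big_mkcond [LHS]big_mkcond; apply: eq_bigr => v _ /=.
  rewrite posE big_ord1 /partial_sums_weight big_mkcond big_ord1 /= mulr1 ffunE.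
  case: (posnP v) => //= v0; case: (ltngtP v T) => [vT|//|<-].
    by rewrite subn_eq0 leqNgt vT mulr0.
  by rewrite subnn mulr1.
rewrite (reindex (ffun_rcons m.+1)); last first.
  by apply: onW_bij; apply: ffun_rcons_bij.
have sumE (x : 'I_M.+1 * {ffun 'I_m.+1 -> 'I_M.+1}) :
    (\sum_r ffun_rcons m.+1 x r = \sum_r x.2 r + x.1)%N.
  rewrite big_ord_recr /= ffun_rcons_max; congr (_ + _)%N.
  by apply: eq_bigr => r _; rewrite ffun_rcons_widen.
have posE (x : 'I_M.+1 * {ffun 'I_m.+1 -> 'I_M.+1}) :
    [forall r, (0 < ffun_rcons m.+1 x r)%N]
    = [forall r, (0 < x.2 r)%N] && (0 < x.1)%N.
  apply/forallP/andP => [h|[/forallP h h2] r].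
    split; last by have := h ord_max; rewrite ffun_rcons_max.
    by apply/forallP => r; have := h (widen_ord (leqnSn _) r);
      rewrite ffun_rcons_widen.
  by rewrite ffunE; case: unliftP => [r'|].
rewrite (eq_bigl (fun x : 'I_M.+1 * {ffun 'I_m.+1 -> 'I_M.+1} =>
   (0 < x.1 <= T)%N && ([forall r, (0 < x.2 r)%N]
     && (\sum_r x.2 r == T - x.1)%N))); last first.
  move=> x; rewrite posE sumE.
  by case: [forall r, _]; rewrite ?andbF //=; lia.
rewrite -(pair_big_dep (fun u : 'I_M.+1 => (0 < u <= T)%N)
  (fun (u : 'I_M.+1) (l : {ffun 'I_m.+1 -> 'I_M.+1}) =>
     [forall r, (0 < l r)%N] && (\sum_r l r == T - u)%N)
  (fun u l => G (ffun_rcons m.+1 (u, l) ord0)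
              * partial_sums_weight m.+1 (ffun_rcons m.+1 (u, l)))) /=.
transitivity (\sum_(u < M.+1 | (0 < u <= T)%N)
   \sum_(v < M.+1 | (0 < v <= T - u)%N)
     G v * ((T - v)%N%:R^-1 * (C u * comp_sum m (T - v - u)))).
  apply: eq_bigr => u uT.
  transitivity (\sum_(l : {ffun 'I_m.+1 -> 'I_M.+1}
           | [forall r, (0 < l r)%N] && (\sum_r l r == T - u)%N)
     (G (l ord0) * (T - l ord0)%N%:R^-1 * C u) * partial_sums_weight m l).
    apply: eq_bigr => l /andP[_ /eqP sl].
    rewrite partial_sums_weight_rcons ffun_rcons_first sumE /= sl subnK; last by lia.
    ring.
  rewrite (IH _ (fun v => G v * (T - v)%N%:R^-1 * C u)); last by lia.
  apply: eq_bigr => v _; rewrite (_ : T - u - v = T - v - u)%N; last by lia.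
  ring.
rewrite (exchange_big_dep (fun v : 'I_M.+1 => (0 < v <= T)%N)) /=; last by lia.
apply: eq_bigr => v vT; rewrite !big_distrr /=.
by apply: eq_bigl => u; lia.
Qed.

End Compositions.

(** * Derivatives and divisibility of products of linear factors *)

Section ProductDerivative.
Variable R : comNzRingType.

Lemma deriv_prod_seq (I : eqType) (s : seq I) (f : I -> {poly R}) : uniq s ->
  (\prod_(i <- s) f i)^`() =
  \sum_(j <- s) (f j)^`() * \prod_(i <- s | i != j) f i.
Proof.
elim: s => [|x s IH] /=; first by rewrite !big_nil -polyC1 derivC.
case/andP=> xs us; rewrite !big_cons derivM IH // eqxx /=; congr (_ * _ + _).
  rewrite [LHS]big_seq_cond [RHS]big_seq_cond; apply: eq_bigl => i.
  by case: (boolP (i \in s)) => //= is_; rewrite (memPn xs).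
rewrite mulr_sumr [LHS]big_seq_cond [RHS]big_seq_cond; apply: eq_bigr => j.
rewrite andbT big_cons => js.
by rewrite (memPnC xs) // mulrCA.
Qed.

Lemma deriv_prod (I : finType) (P : pred I) (f : I -> {poly R}) :
  (\prod_(i | P i) f i)^`() =
  \sum_(j | P j) (f j)^`() * \prod_(i | P i && (i != j)) f i.
Proof.
rewrite -big_filter deriv_prod_seq ?filter_uniq ?index_enum_uniq //.
rewrite big_filter; apply: eq_bigr => j _; congr (_ * _).
by rewrite big_filter_cond.
Qed.

Lemma deriv_prod_XsubC (I : finType) (P : pred I) (z : I -> R) :
  (\prod_(i | P i) ('X - (z i)%:P))^`() =
  \sum_(j | P j) \prod_(i | P i && (i != j)) ('X - (z i)%:P).
Proof. by rewrite deriv_prod; apply: eq_bigr => j _; rewrite derivXsubC mul1r. Qed.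

End ProductDerivative.

Section Divisibility.
Variable F : fieldType.
Implicit Types f g : {poly F}.

(** If f = g y^m with y = X - x, then f' is m g y^(m-1) modulo y^m; when y^m divides f' and m is
    invertible, y divides g, which raises the exponent by one. *)
Lemma dvdp_XsubC_exp_deriv f (x : F) (m : nat) :
  (forall k, (0 < k < m)%N -> k%:R != 0 :> F) -> f.[x] = 0 ->
  ('X - x%:P) ^+ m.-1 %| f^`() -> ('X - x%:P) ^+ m %| f.
Proof.
move=> + fx; elim: m => [|m IH] nz; first by move=> _; rewrite dvd1p.
have [->|m0] := posnP m; first by rewrite expr1 dvdp_XsubCl /root fx.
move=> /= df; have /dvdpP[g fE] : ('X - x%:P) ^+ m %| f.
  apply: IH => [k km|]; first by apply: nz; lia.
  by apply: dvdp_trans df; apply: dvdp_exp2l; lia.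
rewrite fE exprS dvdp_mul2r ?expf_neq0 ?polyXsubC_eq0 //.
move: df; rewrite fE derivM deriv_exp derivXsubC mul1r dvdp_addr ?dvdp_mulIr //.
rewrite -mulr_natr mulrA -{1}(prednK m0) exprSr (mulrC g) -mulrA.
rewrite dvdp_mul2l ?expf_neq0 ?polyXsubC_eq0 // -polyC_natr.
by rewrite mulrC mul_polyC dvdpZr // nz //; lia.
Qed.

Lemma dvdp_prod_XsubC_exp (I : finType) (z : I -> F) (m : nat) f :
  injective z -> (forall i, ('X - (z i)%:P) ^+ m %| f) ->
  (\prod_i ('X - (z i)%:P)) ^+ m %| f.
Proof.
move=> zI zf; rewrite -prodrXl.
elim: (index_enum I) (index_enum_uniq I) => [|x s IH] /=.
  by rewrite big_nil dvd1p.
case/andP=> xs us; rewrite big_cons Gauss_dvdp ?zf ?IH //.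
apply: coprimep_expl; rewrite coprimep_sym coprimep_XsubC.
elim: s xs {IH us} => [|w s IH]; first by rewrite big_nil root1.
rewrite inE negb_or big_cons rootM => /andP[xw xs]; rewrite negb_or IH // andbT.
by rewrite /root horner_exp !hornerE expf_neq0 // subr_eq0 (inj_eq zI).
Qed.

End Divisibility.

(** * Antiderivatives of combinations of the Phi_j *)

(** For M > 0 this is Phi / (x - z_j) written without division, so that it makes sense over F_p[z]
    and over F_p(z) alike. *)
Definition master_div (R : comNzRingType) (n M : nat) (z : 'I_n -> R) (j : 'I_n) :
    {poly R} :=
  (\prod_i ('X - (z i)%:P)) ^+ M.-1 * \prod_(i | i != j) ('X - (z i)%:P).
Arguments master_div {R n} M z j.

Lemma map_master_div {R S : comNzRingType} (f : {rmorphism R -> S}) n M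
    (z : 'I_n -> R) j :
  map_poly f (master_div M z j) = master_div M (f \o z) j.
Proof. by rewrite rmorphM rmorphXn /= !map_prod_XsubC. Qed.

Lemma master_divE {R : comNzRingType} n M (z : 'I_n -> R) j : (0 < M)%N ->
  master_div M z j * ('X - (z j)%:P) = (\prod_i ('X - (z i)%:P)) ^+ M.
Proof.
move=> M0; rewrite -[in RHS](prednK M0) exprSr [in X in _ = _ * X](bigD1 j) //=.
by rewrite -mulrA [_ * ('X - _)]mulrC.
Qed.

Section Relations.

Variables (F : fieldType) (n M : nat) (z : 'I_n -> F).
Hypothesis z_inj : injective z.
Hypothesis M_gt0 : (0 < M)%N.
Hypothesis nat_neq0 : forall m, (0 < m <= M)%N -> m%:R != 0 :> F.

Local Notation L := (\prod_i ('X - (z i)%:P)).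
Local Notation Phi := (master_div M z).

Lemma prod_XsubC_neq0 : L != 0.
Proof. by apply/prodf_neq0 => i _; rewrite polyXsubC_eq0. Qed.

Lemma dvdp_master_div i j : ('X - (z i)%:P) ^+ M.-1 %| Phi j.
Proof.
by apply: dvdp_mulr; apply: dvdp_exp2r; rewrite (bigD1 i) //= dvdp_mulIl.
Qed.

(** After the common factor L^(M-1) is cancelled, evaluation at z_j kills every term but the j-th,
    as in Lagrange interpolation. *)
Lemma master_div_free (c : 'I_n -> F) :
  \sum_j c j *: Phi j = 0 -> forall j, c j = 0.
Proof.
move=> + j; rewrite /master_div.
under [X in X = _]eq_bigr do rewrite -mul_polyC mulrCA mul_polyC.
rewrite -mulr_sumr => /eqP.
rewrite mulf_eq0 (negbTE (expf_neq0 _ prod_XsubC_neq0)) /=.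
move=> /eqP/(congr1 (horner^~ (z j))).
rewrite horner_sum horner0 (bigD1 j) //= [X in _ + X]big1 => [|i ij].
  rewrite addr0 hornerZ => /eqP; rewrite mulf_eq0 => /orP[/eqP //|].
  rewrite horner_prod => /prodf_eq0[i ij].
  by rewrite !hornerE subr_eq0 (inj_eq z_inj) eq_sym (negbTE ij).
by rewrite hornerZ (bigD1 j) 1?eq_sym //= hornerM hornerXsubC subrr mul0r mulr0.
Qed.

Lemma deriv_master : (L ^+ M)^`() = \sum_j M%:R *: Phi j.
Proof.
rewrite deriv_exp deriv_prod_XsubC -scaler_sumr /master_div -mulr_sumr.
by rewrite mulrC scaler_nat.
Qed.

(* Partial fractions of y^(-w) / (y - d), multiplied by y^M (y - d). *)
Lemma geometric_split (y : {poly F}) (d : F) (w : nat) : d != 0 -> (w <= M)%N ->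
  y ^+ (M - w) = (d ^- w)%:P * y ^+ M
    - (y - d%:P) * \sum_(v < w) (d ^- (w - v))%:P * y ^+ (M - v.+1).
Proof.
move=> d0; elim: w => [|w IH] wM.
  by rewrite big_ord0 mulr0 subr0 subn0 expr0 invr1 mul1r.
rewrite big_ord_recr /= subSnn.
have -> : \sum_(v < w) (d ^- (w.+1 - v))%:P * y ^+ (M - v.+1) =
    (d^-1)%:P * \sum_(v < w) (d ^- (w - v))%:P * y ^+ (M - v.+1).
  rewrite mulr_sumr; apply: eq_bigr => v _.
  by rewrite mulrA -polyCM -invfM -exprS subSn // ltnW.
have /(_ (ltnW wM)) := IH; rewrite -{1}(subnSK wM) exprS.
set S := \sum_(v < w) _; move=> E.
have d1 : (d^-1)%:P * d%:P = 1 :> {poly F} by rewrite -polyCM mulVf.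
have -> : d ^- w.+1 = d^-1 * d ^- w by rewrite exprS invfM mulrC.
rewrite expr1.
(* This is d y^(M-w-1) = y^(M-w) - (y - d) y^(M-w-1) divided by d, with the induction hypothesis put
   in for y^(M-w). *)
transitivity ((d^-1)%:P * ((d ^- w)%:P * y ^+ M - (y - d%:P) * S)
  - y * (d^-1)%:P * y ^+ (M - w.+1) + ((d^-1)%:P * d%:P) * y ^+ (M - w.+1)).
  by rewrite -E d1; ring.
ring.
Qed.

(** * The antiderivative attached to a single index i *)

Section OneRelation.

Variables (i : 'I_n) (b : nat -> F).

Definition power_sum (m : nat) : F := \sum_(j < n | j != i) M%:R / (z j - z i) ^+ m.

(** This says that (Phi r_i)' / Phi has no pole of order v + 1 at z_i: expanding M / (x - z_j) in
    powers of x - z_i contributes the power sums. At v = M both sides are 0, so b_M stays free. *)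
Hypothesis b_rec : forall v, (0 < v <= M)%N ->
  (M - v)%:R * b v = \sum_(w < M.+1 | (v < w)%N) power_sum (w - v) * b w.

Local Notation y := ('X - (z i)%:P).
Local Notation Li := (\prod_(j | j != i) ('X - (z j)%:P)).
Local Notation N j := (\prod_(l | (l != i) && (l != j)) ('X - (z l)%:P)).

(* Phi r_i, written without negative powers of x - z_i *)
Definition primitive : {poly F} :=
  Li ^+ M * \sum_(w < M.+1 | (0 < w)%N) (b w)%:P * y ^+ (M - w).

(* the residue of (Phi r_i)' / Phi at z_j *)
Definition residue (j : 'I_n) : F :=
  \sum_(w < M.+1 | (0 < w)%N)
    (if j == i then - power_sum w else M%:R / (z j - z i) ^+ w) * b w.

(** Each j != i contributes M r_i / (x - z_j) to (Phi r_i)' / Phi; [geometric_split] separates its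
    simple pole at z_j from its poles at z_i. The latter, summed over j, cancel against the
    derivative of [Q] except for a simple pole. *)
Lemma deriv_primitive : primitive^`() = \sum_j residue j *: Phi j.
Proof.
have LE : L = y * Li by rewrite (bigD1 i).
have LiE j : j != i -> Li = ('X - (z j)%:P) * N j by move=> ji; rewrite (bigD1 j).
have LjE j : j != i -> \prod_(l | l != j) ('X - (z l)%:P) = y * N j.
  move=> ji; rewrite (bigD1 i) 1?eq_sym //=; congr (_ * _).
  by apply: eq_bigl => l; rewrite andbC.
have PhiE j : j != i -> Phi j = y ^+ M * (Li ^+ M.-1 * N j).
  move=> ji; rewrite /master_div LE (LjE _ ji) -[in RHS](prednK M_gt0) exprSr exprMn.
  ring.
have Phii : Phi i = Li ^+ M * y ^+ M.-1.
  by rewrite /master_div LE -[in RHS](prednK M_gt0) exprSr exprMn; ring.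
have LiM j : j != i -> Li ^+ M.-1 * N j * ('X - (z j)%:P) = Li ^+ M.
  by move=> ji; rewrite -[in RHS](prednK M_gt0) exprSr {3}(LiE _ ji); ring.
have splitE j w : j != i -> (w <= M)%N -> Li ^+ M.-1 * N j * y ^+ (M - w) =
   ((z j - z i) ^- w)%:P * Phi j
    - Li ^+ M * \sum_(v < w) ((z j - z i) ^- (w - v))%:P * y ^+ (M - v.+1).
  move=> ji wM; rewrite (geometric_split y (z j - z i)) //; last first.
    by rewrite subr_eq0 (inj_eq z_inj).
  rewrite (PhiE _ ji) -(LiM _ ji).
  have -> : y - (z j - z i)%:P = 'X - (z j)%:P by rewrite polyCB; ring.
  ring.
pose Q := \sum_(w < M.+1 | (0 < w)%N) (b w)%:P * y ^+ (M - w).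
pose S := \sum_(w < M.+1 | (0 < w)%N) \sum_(v < M.+1 | (v < w)%N)
   (power_sum (w - v) * b w)%:P * y ^+ (M - v.+1).
(* The terms with v = 0 are the simple pole at z_i, with the sign of the residue reversed; for v >
   0, [b_rec] turns the sum over w into (M - v) b_v, the coefficient in the derivative of [Q]. *)
have derivQ : S = (\sum_(w < M.+1 | (0 < w)%N) power_sum w * b w)%:P * y ^+ M.-1
    + Q^`().
  rewrite /S (exchange_big_dep xpredT) //= (bigD1 ord0) //=; congr (_ + _).
    rewrite rmorph_sum mulr_suml; apply: eq_big => [w|w w0]; first by rewrite andbb.
    by rewrite subn0 subn1.
  rewrite /Q raddf_sum /=; apply: eq_big => [v|v v0]; first by rewrite lt0n.
  rewrite (eq_bigl (fun w : 'I_M.+1 => (v < w)%N)); last by move=> w; lia.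
  rewrite -mulr_suml -rmorph_sum /= -b_rec; last first.
    by move: v0 (ltn_ord v); rewrite -val_eqE /=; lia.
  rewrite derivM derivC mul0r add0r deriv_exp derivXsubC mul1r polyCM polyC_natr.
  by rewrite -mulr_natr -subn1 -subnDA addn1; ring.
have -> : primitive^`() = \sum_(j | j != i) residue j *: Phi j - Li ^+ M * S
    + Li ^+ M * Q^`().
  rewrite /primitive -/Q derivM deriv_exp deriv_prod_XsubC; congr (_ + _).
  transitivity (\sum_(j < n | j != i) \sum_(w < M.+1 | (0 < w)%N)
     (M%:R * b w)%:P * (Li ^+ M.-1 * N j * y ^+ (M - w))).
    rewrite -mulr_natl mulr_suml mulr_sumr mulr_suml; apply: eq_bigr => j ji.
    rewrite mulr_sumr; apply: eq_bigr => w _.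
    by rewrite polyCM polyC_natr; ring.
  transitivity (\sum_(j < n | j != i) (residue j *: Phi j
     - Li ^+ M * \sum_(w < M.+1 | (0 < w)%N) \sum_(v < M.+1 | (v < w)%N)
         (M%:R / (z j - z i) ^+ (w - v) * b w)%:P * y ^+ (M - v.+1))).
    apply: eq_bigr => j ji; rewrite /residue (negbTE ji) scaler_suml mulr_sumr.
    rewrite -sumrB; apply: eq_bigr => w _.
    rewrite splitE // ?(big_ord_widen M.+1 (fun v =>
      ((z j - z i) ^- (w - v))%:P * y ^+ (M - v.+1))); try by have := ltn_ord w; lia.
    rewrite mulrBr -mul_polyC mulrA -polyCM; congr (_%:P * _ - _); first by ring.
    rewrite mulrCA; congr (_ * _); rewrite mulr_sumr; apply: eq_bigr => v _.
    by rewrite mulrA -polyCM; congr (_%:P * _); ring.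
  rewrite sumrB -mulr_sumr; congr (_ - _ * _).
  rewrite exchange_big; apply: eq_bigr => w _.
  rewrite exchange_big; apply: eq_bigr => v _.
  by rewrite -mulr_suml -rmorph_sum -mulr_suml.
rewrite derivQ [RHS](bigD1 i) //= Phii -mul_polyC.
have -> : residue i = - \sum_(w < M.+1 | (0 < w)%N) power_sum w * b w.
  by rewrite /residue eqxx -sumrN; apply: eq_bigr => w _; rewrite mulNr.
rewrite polyCN; ring.
Qed.

Lemma horner_primitive_neq j : j != i -> primitive.[z j] = 0.
Proof.
move=> ji; rewrite hornerM horner_exp (bigD1 j) //= hornerM hornerXsubC subrr.
by rewrite mul0r expr0n gtn_eqF // mul0r.
Qed.

Lemma horner_primitive_eq : b M = 1 -> primitive.[z i] != 0.
Proof.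
move=> bM; rewrite hornerM horner_exp mulf_neq0 //.
  rewrite expf_neq0 // horner_prod; apply/prodf_neq0 => j ji.
  by rewrite hornerXsubC subr_eq0 (inj_eq z_inj) eq_sym.
rewrite (bigD1 ord_max) //= bM subnn expr0 mulr1 hornerD hornerC.
rewrite horner_sum [X in _ + X]big1 ?addr0 ?oner_eq0 // => w /andP[w0 wM].
rewrite hornerM horner_exp hornerXsubC subrr expr0n subn_eq0 leqNgt.
have -> : (w < M)%N by move: wM (ltn_ord w); rewrite -val_eqE /=; lia.
by rewrite mulr0.
Qed.

Lemma size_master : size (L ^+ M) = (n * M).+1.
Proof.
rewrite -(prednK (n := size _)) ?lt0n ?size_poly_eq0 ?expf_neq0 ?prod_XsubC_neq0 //.
by rewrite size_exp size_prod_XsubC /= -sum1_size sum1_card card_ord.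
Qed.

(** The sum over w starts at 1, so that factor has degree below M, while [Li ^+ M] has degree (n -
    1) M. *)
Lemma size_primitive : (size primitive <= n * M)%N.
Proof.
have Li0 : Li != 0 by apply/prodf_neq0 => j _; rewrite polyXsubC_eq0.
have sLi : size Li = n.
  have := size_prod_XsubC (index_enum 'I_n) z.
  rewrite (bigD1 i) //= size_monicM ?monicXsubC // size_XsubC => -[].
  rewrite add0n => ->.
  by rewrite -sum1_size sum1_card card_ord.
apply: leq_trans (size_polyMleq _ _) _.
have -> : size (Li ^+ M) = (n.-1 * M).+1.
  rewrite -(prednK (n := size _)) ?lt0n ?size_poly_eq0 ?expf_neq0 //.
  by rewrite size_exp sLi.
rewrite addSn /=.
have : (size (\sum_(w < M.+1 | (0 < w)%N) (b w)%:P * y ^+ (M - w))%R <= M)%N.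
  apply: leq_trans (size_sum _ _ _) _; apply/bigmax_leqP => w w0.
  rewrite mul_polyC; apply: leq_trans (size_scale_leq _ _) _.
  by rewrite size_exp_XsubC; lia.
have n0 : (0 < n)%N by apply: leq_ltn_trans (ltn_ord i).
by rewrite -[X in (_ <= X * _)%N](prednK n0) mulSn addnC leq_add2r.
Qed.

End OneRelation.

Lemma span_relations (b : 'I_n -> nat -> F) (c : 'I_n -> F) (h : {poly F}) :
  (forall i v, (0 < v <= M)%N ->
    (M - v)%:R * b i v = \sum_(w < M.+1 | (v < w)%N) power_sum i (w - v) * b i w) ->
  (forall i, b i M = 1) ->
  h^`() = \sum_j c j *: Phi j -> (size h <= (n * M).+1)%N ->
  exists (c0 : F) (g : 'I_n -> F),
    forall j, c j = c0 + \sum_i g i * residue i (b i) j.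
Proof.
move=> b_rec bM hc sh.
(* At z_i only the i-th primitive is nonzero, so these quotients make [f] vanish at every z_i. *)
pose g i := h.[z i] / (primitive i (b i)).[z i].
pose f := h - \sum_i g i *: primitive i (b i).
have f'E : f^`() = \sum_j (c j - \sum_i g i * residue i (b i) j) *: Phi j.
  rewrite derivB hc raddf_sum /=.
  under [X in _ - X]eq_bigr => i _.
    rewrite derivZ (deriv_primitive _ _ (b_rec i)) scaler_sumr.
    under eq_bigr do rewrite scalerA.
    over.
  rewrite exchange_big -sumrB; apply: eq_bigr => j _.
  by rewrite scalerBl scaler_suml.
have f0 i : f.[z i] = 0.
  rewrite hornerD hornerN horner_sum (bigD1 i) //= [X in _ - (_ + X)]big1 => [|j ji].
    by rewrite addr0 hornerZ divfK ?subrr // horner_primitive_eq.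
  by rewrite hornerZ horner_primitive_neq ?mulr0 // eq_sym.
have /dvdpP[e fE] : L ^+ M %| f.
  apply: dvdp_prod_XsubC_exp => // i; apply: dvdp_XsubC_exp_deriv => //.
    by move=> m mM; apply: nat_neq0; lia.
  rewrite f'E; apply: (big_ind (fun q => _ %| q)) => [|*|j _]; first exact: dvdp0.
    exact: dvdp_add.
  by rewrite -mul_polyC dvdp_mull // dvdp_master_div.
have sf : (size f <= (n * M).+1)%N.
  rewrite (leq_trans (size_polyD _ _)) // geq_max sh size_polyN.
  apply: leq_trans (size_sum _ _ _) _; apply/bigmax_leqP => i _.
  apply: leq_trans (size_scale_leq _ _) _; apply: leqW; exact: size_primitive.
have [c0 eE] : exists c0, e = c0%:P.
  have [->|e0] := eqVneq e 0; first by exists 0.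
  have L0 : L ^+ M != 0 by rewrite expf_neq0 ?prod_XsubC_neq0.
  exists e`_0; apply: size1_polyC; move: sf; rewrite fE size_mul // size_master.
  by rewrite addnS -[(n * M).+1]add1n leq_add2r.
(* The factor M comes from Phi' = M (Phi_1 + ... + Phi_n); the coefficients of f' = (c0 Phi)' are
   then compared by linear independence of the Phi_j. *)
exists (c0 * M%:R), g => j; apply/eqP; rewrite -subr_eq0; apply/eqP.
pose d j := c j - (c0 * M%:R + \sum_i g i * residue i (b i) j).
apply: (master_div_free d); rewrite /d.
transitivity (f^`() - (c0%:P * L ^+ M)^`()); last by rewrite fE eE subrr.
rewrite f'E mul_polyC derivZ deriv_master scaler_sumr -sumrB.
apply: eq_bigr => l _; rewrite scalerA -scalerBl; congr (_ *: _); ring.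
Qed.

End Relations.

(** * Antiderivatives in characteristic p and the annihilator *)

Lemma antiderivative (F : fieldType) (p : nat) (g : {poly F}) :
  p \in [pchar F] -> (forall m, (p %| m.+1)%N -> g`_m = 0) ->
  exists2 h : {poly F}, h^`() = g & (size h <= (size g).+1)%N.
Proof.
(* When p divides m this divides by 0 and gives 0; those coefficients of an antiderivative do not
   affect its derivative. *)
move=> pF g0; pose e m := g`_m.-1 / m%:R.
exists (\poly_(m < (size g).+1) e m); last exact: size_poly.
apply/polyP => m; rewrite coef_deriv coef_poly ltnS.
have [mg|gm] := ltnP m (size g); last by rewrite mul0rn nth_default.
have [/[dup] /g0 gm0 _|pm] := boolP (p %| m.+1)%N.
  by rewrite /e /= gm0 mul0r mul0rn.
by rewrite -mulr_natr divfK // -(dvdn_pcharf pF).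
Qed.

Lemma coef_deriv_pchar (F : fieldType) (p : nat) (h : {poly F}) (m : nat) :
  p \in [pchar F] -> (p %| m.+1)%N -> h^`()`_m = 0.
Proof.
move=> pF; rewrite (dvdn_pcharf pF) => /eqP m0.
by rewrite coef_deriv -mulr_natr m0 mulr0.
Qed.

(** The obstructions to integrating g = sum_j c_j Phi_j are its coefficients at x^(lp-1). Since g
    has degree below nM < (N + 1) p, those with l > N vanish by themselves. *)
Lemma annihilatorP (F : fieldType) (p n M N : nat) (z c : 'I_n -> F) :
  p \in [pchar F] -> (0 < M)%N -> (n * M < N.+1 * p)%N ->
  (forall l, (1 <= l <= N)%N ->
     \sum_j c j * (master_div M z j)`_(l * p - 1) = 0)
  <-> exists2 h : {poly F},
        h^`() = \sum_j c j *: master_div M z j & (size h <= (n * M).+1)%N.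
Proof.
move=> pF M0 nMp; have p0 : (0 < p)%N by apply: prime_gt0; apply: pcharf_prime pF.
pose g : {poly F} := \sum_j c j *: master_div M z j.
have gE m : g`_m = \sum_j c j * (master_div M z j)`_m.
  by rewrite coef_sum; apply: eq_bigr => j _; rewrite coefZ.
have sg : (size g <= n * M)%N.
  apply: leq_trans (size_sum _ _ _) _; apply/bigmax_leqP => j _.
  apply: leq_trans (size_scale_leq _ _) _.
  have := size_master F n M z; rewrite -(master_divE _ _ _ j) //.
  have [->|Phi0] := eqVneq (master_div M z j) 0; first by rewrite size_poly0.
  rewrite mulrC size_monicM ?monicXsubC ?size_XsubC // => -[].
  by rewrite add0n => ->.
split=> [ann|[h hE _] l lN].
  have [m|h hE sh] := @antiderivative _ p g pF; last first.
    by exists h => //; apply: leq_trans sh _.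
  case/dvdnP=> l ml; have [lN|Nl] := leqP l N.
    have l0 : (0 < l)%N by case: l ml {lN}.
    by rewrite (_ : m = l * p - 1)%N ?gE ?ann ?l0 //; lia.
  rewrite nth_default //; apply: leq_trans sg _; rewrite -ltnS ml.
  by apply: leq_trans nMp _; rewrite leq_mul2r Nl orbT.
rewrite -gE /g -hE (@coef_deriv_pchar _ p) //.
have ? : (0 < l * p)%N by rewrite muln_gt0 p0 andbT; case/andP: lN.
by rewrite (_ : (l * p - 1).+1 = l * p)%N ?dvdn_mull //; lia.
Qed.

(** * The relations over F_p(z) *)

Section RationalFunctions.

Variables (p n M : nat).
Hypothesis p_prime : prime p.
Hypothesis M_gt0 : (0 < M)%N.
Hypothesis M_ltp : (M < p)%N.

Local Notation K := (ratfun p n).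
Local Notation z := (@zvar p n).

Lemma pchar_ratfun : p \in [pchar K].
Proof.
apply: (rmorph_pchar (@tofrac {mpoly 'F_p[n]})).
by apply: (rmorph_pchar (@mpolyC n 'F_p)); apply: pchar_Fp.
Qed.

Lemma ratfun_nat_neq0 m : (0 < m <= M)%N -> m%:R != 0 :> K.
Proof. by move=> mM; rewrite -(dvdn_pcharf pchar_ratfun) gtnNdvd //; lia. Qed.

Lemma zvar_inj : injective z.
Proof.
move=> i j /eqP; rewrite tofrac_eq => /eqP/(congr1 (mcoeff U_(i)%MM)).
by rewrite !mcoeffXU eqxx; case: eqVneq.
Qed.

Lemma PsolE i j : Psol p n M i 0 j = (master_div M z j)`_i.
Proof.
pose zA (j : 'I_n) : {mpoly 'F_p[n]} := 'X_j.
rewrite !mxE; have -> : master p n M %/ ('X - (zA j)%:P) = master_div M zA j.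
  rewrite /master prodrXl -(master_divE _ _ zA j) //.
  by rewrite Pdiv.IdomainMonic.mulpK // monicXsubC.
by rewrite -coef_map map_master_div.
Qed.

(** These are the b_v of the polar part r_i: v stands for the first part l_0, and the remaining
    parts form a composition of M - v. *)
Definition relation_coef (i : 'I_n) (v : nat) : K :=
  comp_total _ M (Csum p M i) (M - v).

Lemma relation_coef_rec i v : (0 < v <= M)%N ->
  (M - v)%:R * relation_coef i v =
  \sum_(w < M.+1 | (v < w)%N) power_sum _ n M z i (w - v) * relation_coef i w.
Proof.
move=> vM; rewrite comp_total_rec; first last.
- by lia.
- by move=> m mM; apply: ratfun_nat_neq0; lia.
(* The substitution is w = u + v. When u + v exceeds M, [inord] falls back to 0, and the condition v
   < w excludes that case. *)
rewrite [RHS](reindex_onto (fun u : 'I_M.+1 => inord (u + v))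
   (fun w : 'I_M.+1 => inord (w - v))) /=; last first.
  move=> w vw; have wM := ltn_ord w.
  by apply: val_inj; rewrite /= !inordK ?subnK //; lia.
apply: eq_big => [u|u uv].
  apply/idP/andP => [uv|[vu /eqP/(congr1 val)]].
    rewrite inordK; last by lia.
    split; first by lia.
    by apply/eqP/val_inj; rewrite /= inordK ?addnK.
  have uM := ltn_ord u.
  move: vu; have [uvM|uvM] := ltnP (u + v) M.+1.
    by rewrite inordK //; lia.
  by rewrite /inord /insubd insubF //=; lia.
rewrite inordK; last by lia.
rewrite addnK /relation_coef; congr (_ * comp_total _ _ _ _); lia.
Qed.

(** Grouping the compositions by their first part v and summing over their lengths leaves b_v as the
    factor of [G v]. *)
Lemma relation_vecE i j :
  relation_vec p M i 0 j = residue _ _ M z i (relation_coef i) j.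
Proof.
rewrite mxE.
pose G v := if j == i then - Csum p M i v else M%:R / (zvar p j - zvar p i) ^+ v.
transitivity (\sum_(m < M) \sum_(v < M.+1 | (0 < v <= M)%N)
    G v * comp_sum _ M (Csum p M i) m (M - v)).
  by apply: eq_bigr => m _; rewrite -sum_compositions.
rewrite exchange_big; apply: eq_big => [v|v _].
  by have := ltn_ord v; lia.
by rewrite /= -mulr_sumr.
Qed.

Lemma relationE i (v : 'rV[K]_n) :
  relation M i v = \sum_j relation_vec p M i 0 j * v 0 j.
Proof.
under [RHS]eq_bigr do rewrite mxE mulr_suml.
rewrite exchange_big; apply: eq_bigr => m _ /=.
under [RHS]eq_bigr do rewrite mulr_suml.
rewrite exchange_big; apply: eq_bigr => l _ /=.
rewrite [RHS](bigD1 i) //= eqxx mulrBl mulr_suml [RHS]addrC; congr (_ + _).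
  by apply: eq_bigr => j /negbTE ->; rewrite mulrAC.
by rewrite !mulNr mulrAC.
Qed.

End RationalFunctions.

Theorem corollary4p5 (p q k n a M : nat) (hp : prime p) (hq : prime q)
    (hk : (0 < k)%N) (hn : n = (k * q + 1)%N) (hpn : (n < p)%N)
    (ha : (1 <= a < q)%N) (haq : (q %| a * p - 1)%N)
    (hM : M = ((a * p - 1) %/ q)%N) :
  (forall s : nat, (1 <= s <= a * k)%N ->
     \sum_(j < n) Psol p n M (s * p - 1) 0 j = 0
     /\ forall i : 'I_n, relation M i (Psol p n M (s * p - 1)) = 0)
  /\ (forall c : 'rV[ratfun p n]_n,
        inAnn M a k c <->
        c \in <<const_mx 1 :: [seq relation_vec p M i | i <- enum 'I_n]>>%VS).
Proof.
have qM : (M * q = a * p - 1)%N by rewrite hM divnK.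
have q1 := prime_gt1 hq; have p1 := prime_gt1 hp.
have ap1 : (p <= a * p)%N by rewrite leq_pmull //; case/andP: ha.
have M0 : (0 < M)%N by case: (posnP M) qM => // ->; lia.
(* From a < q one gets M q = a p - 1 < p q. *)
have Mp : (M < p)%N.
  rewrite -(ltn_pmul2r (ltnW q1)) qM mulnC.
  have : (a * p <= p * q)%N by rewrite mulnC leq_mul2l; lia.
  by lia.
(* With n = kq + 1 and Mq = ap - 1, nM = k(ap - 1) + M < akp + p. Thus l = 1, ..., ak cover all
   multiples of p up to nM. *)
have nMp : (n * M < (a * k).+1 * p)%N.
  have -> : (n * M = k * (a * p - 1) + M)%N by rewrite hn -qM; lia.
  have -> : ((a * k).+1 * p = k * (a * p) + p)%N by lia.
  have : (k * (a * p - 1) <= k * (a * p))%N by rewrite leq_mul2l leq_subr orbT.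
  by lia.
pose K := ratfun p n.
pose Phi := master_div M (@zvar p n).
have annP (c : 'rV[K]_n) : inAnn M a k c <-> exists2 h : {poly K},
    h^`() = \sum_j c 0 j *: Phi j & (size h <= (n * M).+1)%N.
  rewrite -(@annihilatorP K p n M (a * k) _ (fun j => c 0 j)
    (pchar_ratfun p n hp)) //.
  by split=> ann l lN; rewrite -[RHS](ann l lN); apply: eq_bigr => j _;
    rewrite PsolE.
have nz := ratfun_nat_neq0 p n M hp M0 Mp.
have z_inj := zvar_inj p n.
have coef_rec := relation_coef_rec p n M hp M0 Mp.
have ann1 : inAnn M a k (const_mx 1 : 'rV[K]_n).
  apply/annP; exists ((M%:R^-1)%:P * (\prod_i ('X - (zvar p i)%:P)) ^+ M).
    rewrite mul_polyC derivZ deriv_master // scaler_sumr; apply: eq_bigr => j _.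
    by rewrite scalerA mulVf ?nz ?M0 ?leqnn // mxE.
  rewrite mul_polyC; apply: leq_trans (size_scale_leq _ _) _.
  by rewrite size_master.
have annR (i : 'I_n) : inAnn M a k (relation_vec p M i).
  apply/annP; exists (primitive _ _ M (@zvar p n) i (relation_coef p n M i)).
    rewrite deriv_primitive //; last exact: coef_rec.
    by apply: eq_bigr => j _; rewrite relation_vecE.
  by apply: leqW; apply: size_primitive.
split=> [s sN|c].
  split=> [|i]; last by rewrite relationE annR.
  rewrite -[RHS](ann1 s sN); apply: eq_bigr => j _.
  by rewrite [const_mx _ _ _]mxE mul1r.
split=> [/annP[h hE sh]|].
  have coefM i : relation_coef p n M i M = 1.
    by rewrite /relation_coef subnn comp_total0.
  have [c0 [g cE]] := span_relations _ _ M _ z_inj M0 nz (relation_coef p n M)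
    (fun j => c 0 j) h coef_rec coefM hE sh.
  have -> : c = c0 *: const_mx 1 + \sum_i g i *: relation_vec p M i.
    apply/rowP => j; rewrite cE !mxE mulr1 summxE; congr (_ + _).
    by apply: eq_bigr => i _; rewrite mxE relation_vecE.
  apply: memvD; first by apply/memvZ/memv_span; rewrite mem_head.
  apply: memv_suml => i _; apply/memvZ/memv_span; rewrite inE map_f ?orbT //.
  exact: mem_enum.
(* Conversely, the annihilator conditions are linear in c, so it suffices to check them on the
   generators. *)
set X := _ :: _ => /(@coord_span _ _ _ (in_tuple X)) -> l lN.
have annX (x : 'rV[K]_n) : x \in X -> inAnn M a k x.
  by rewrite inE => /predU1P[->|/mapP[i _ ->]].
under eq_bigr do rewrite summxE mulr_suml.
rewrite exchange_big big1 // => i _ /=.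
under eq_bigr do rewrite mxE -mulrA.
by rewrite -mulr_sumr annX ?mulr0 // mem_nth.
Qed.
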